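(* Let $n$ be a positive integer and let $G$ be a properly edge-colored subgraph of the $n$-dimensional hypercube $Q_n$. Then for every tree $T$ with at most $\delta(G)$ edges, there exists a rainbow copy of $T$ in $G$.
   Context: The $n$-dimensional hypercube $Q_n$ is the graph with vertex set $\mathbb{F}_2^n$ in which two vertices are adjacent if and only if they differ in exactly one coordinate. $G$ is an arbitrary (not necessarily induced) subgraph of $Q_n$ with at least one vertex, and $\delta(G)$ denotes its minimum degree. An edge-coloring (with an arbitrary set of colors) is proper if any two distinct edges sharing an endpoint receive different colors. A rainbow copy of $T$ in an edge-colored graph $G$ is a (not necessarily induced) subgraph of $G$ isomorphic to $T$ all of whose edges have pairwise distinct colors. *)

(* Defs.v *)
From mathcomp Require Import all_boot all_order all_algebra.

Set Implicit Arguments.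
Unset Strict Implicit.
Unset Printing Implicit Defensive.

(* A finite simple graph whose vertices are drawn from U. Not every element of
   U has to be a vertex, so that subgraphs may have fewer vertices. *)
Record sgraph (U : finType) := SGraph {
  verts : {set U};
  edges : {set {set U}};
  edgesP : [forall e in edges, (e \subset verts) && (#|e| == 2)]
}.

Definition edge (U : finType) (G : sgraph U) : Type :=
  {e : {set U} | e \in edges G}.

Definition adj (U : finType) (G : sgraph U) : rel U :=
  fun x y => [set x; y] \in edges G.

Definition degree (U : finType) (G : sgraph U) (x : U) : nat :=
  #|[set y in verts G | adj G x y]|.

(* Every degree is at most #|verts G|, so the default value of the iterated
   minimum is irrelevant as soon as G has a vertex. *)
Definition min_degree (U : finType) (G : sgraph U) : nat :=
  \big[minn/#|verts G|]_(x in verts G) degree G x.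

Definition subgraph (U : finType) (H G : sgraph U) : bool :=
  (verts H \subset verts G) && (edges H \subset edges G).

Definition isomorphic (U W : finType) (G : sgraph U) (H : sgraph W) : Prop :=
  exists f : {x | x \in verts G} -> {y | y \in verts H},
    bijective f /\
    forall x y, adj G (val x) (val y) = adj H (val (f x)) (val (f y)).

Definition connected (U : finType) (G : sgraph U) : Prop :=
  {in verts G &, forall x y, connect (adj G) x y}.

Definition acyclic (U : finType) (G : sgraph U) : Prop :=
  forall s : seq U, 3 <= size s -> ~ ucycle (adj G) s.

Definition tree (U : finType) (G : sgraph U) : Prop :=
  [/\ verts G != set0, connected G & acyclic G].

Definition cube_adj (n : nat) (x y : 'rV['F_2]_n) : bool :=
  #|[set i | x ord0 i != y ord0 i]| == 1.

Definition cube_edges (n : nat) : {set {set 'rV['F_2]_n}} :=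
  [set e | [exists x, exists y, (e == [set x; y]) && cube_adj x y]].

Lemma cube_edgesP (n : nat) :
  [forall e in cube_edges n, (e \subset [set: 'rV['F_2]_n]) && (#|e| == 2)].
Proof.
apply/forall_inP => e; rewrite inE.
case/existsP => x /existsP[y /andP[/eqP-> xy]].
rewrite subsetT cards2; case: (eqVneq x y) xy => // ->.
rewrite /cube_adj (_ : [set i | _] = set0) ?cards0 //.
by apply/setP => i; rewrite !inE eqxx.
Qed.

Definition hypercube (n : nat) : sgraph 'rV['F_2]_n := SGraph (cube_edgesP n).

Definition proper_coloring (U : finType) (G : sgraph U) (C : Type)
    (c : edge G -> C) : Prop :=
  forall e f : edge G, e <> f -> val e :&: val f != set0 -> c e <> c f.

Definition rainbow (U : finType) (G : sgraph U) (C : Type) (c : edge G -> C)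
    (H : sgraph U) : Prop :=
  forall e f : edge G,
    val e \in edges H -> val f \in edges H -> e <> f -> c e <> c f.

Definition rainbow_copy (U W : finType) (G : sgraph U) (C : Type)
    (c : edge G -> C) (T : sgraph W) (H : sgraph U) : Prop :=
  [/\ subgraph H G, isomorphic T H & rainbow c H].

(* Main.v *)
Require Import Defs.
From mathcomp Require Import all_boot all_order all_algebra.
From mathcomp Require Import zify.
From Stdlib Require Import ClassicalEpsilon.

(** The tree is embedded greedily, one edge at a time, and the whole difficulty
    is to keep the image a tree.  Let [d] be the number of edges of [T].  When
    the edge in position [t] is embedded, at most [t - 1] of the at least [d]
    edges of [G] available at its upper end carry a colour that is already in
    use, so [d - t] further ones, as many as there are tree edges still to
    come, may be forbidden.  We spend this freedom on directions, the direction
    of an edge of the cube being the coordinate in which its ends differ: the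
    new edge must avoid the directions of a well-chosen set of at most [d - t]
    earlier edges ([card_guarded], [partial_embeddingS]).  It avoids the
    directions of the earlier edges at the same vertex for free, because equal
    directions there would mean equal edges, hence equal colours.

    Suppose that two vertices [u] and [w] of [T] have the same image.  Then
    every direction occurs an even number of times on the path from [u] to [w]
    ([even_directions]), so that no set of edges with distinct directions makes
    up more than half of the path ([card_injective_part]).  It is therefore
    enough to guarantee that on every path of even length some majority of the
    edges has distinct directions ([dir_inj_on_majority]).

    Two choices achieve this within the budget.  Root [T] at a vertex that has
    a leaf neighbour [l].  Name an edge by its lower end [v], let [depth v] be
    its distance to the root and [height v] the length of the longest path
    going down from [v], and embed the edges by increasing [depth - height],
    except that [l] comes last ([clock]).  For any ancestor [z], and for the
    edges below [z] with their depths counted from [z], this order takes all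
    the upper halves of the descending paths from [z] before any lower half.
    Secondly, the directions that [e] avoids are bought one by one by the edges
    [g] that come after [e] ([guard]).  An edge [g] below [e] with height [k]
    buys the ancestor of [e] that is [k + 2] steps up, and the leaf [l] buys
    one more ancestor.  An edge [g] of height [k] elsewhere, which branches off
    at an ancestor [z] of [e], buys its own ancestor at depth [k + 1] below
    [z].

    On a path whose two descending sides have lengths [x] and [y], the majority
    is formed by the top [uphalf x + 1] edges of one side and the top [y./2] of
    the other.  The longer share goes to the side whose edge at position
    [uphalf + 1] comes first ([dir_inj_on_halves]). *)

Set Implicit Arguments.
Unset Strict Implicit.
Unset Printing Implicit Defensive.

Import GRing.Theory.

(** * Rooted trees *)

(** Arithmetic on depths, heights and clock values, forgetting memberships. *)
Ltac nat_lia := repeat match goal with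
  | x := _ |- _ => clearbody x
  | H : is_true (in_mem _ _) |- _ => clear H
  | H : is_true (~~ in_mem _ _) |- _ => clear H
  | H : is_true (~~ (_ == _)) |- _ => clear H
  | H : forall _, _ |- _ => clear H
  end; lia.

(** Edges are not recorded: the edge from a nonroot vertex to its parent is
    named by that vertex, so that sets of edges are sets of vertices. *)
Record rooted_tree (V : finType) := RootedTree {
  tree_root : V;
  parent : V -> V;
  depth : V -> nat;
  parent_root : parent tree_root = tree_root;
  depth_root : depth tree_root = 0;
  depth_parent : forall v, v != tree_root -> depth v = (depth (parent v)).+1
}.

Section Ancestors.

Variables (V : finType) (R : rooted_tree V).

Local Notation rt := (tree_root R).
Local Notation par := (parent R).
Local Notation dep := (depth R).

(** The nonroot vertices from [v] upwards, [v] included: in other words the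
    edges of the path from [v] to the root. *)
Definition ancestors (v : V) : {set V} :=
  [set iter i par v | i : 'I_(dep v)].

Lemma depth_eq0 v : (dep v == 0) = (v == rt).
Proof.
by have [->|/depth_parent->] := eqVneq v rt; rewrite ?depth_root ?eqxx.
Qed.

Lemma parent_neq v : v != rt -> par v != v.
Proof. by move=> v0; apply/eqP => e; have := depth_parent v0; rewrite e; lia. Qed.

Lemma depth_iter i v : dep (iter i par v) = dep v - i.
Proof.
elim: i => [|i IHi] /=; first by rewrite subn0.
have [e|/depth_parent e] := eqVneq (iter i par v) rt; last first.
  by rewrite subnS -IHi e.
by rewrite e parent_root subnS -IHi e depth_root.
Qed.

Lemma ancestorsP f v :
  reflect (exists2 i, i < dep v & f = iter i par v) (f \in ancestors v).
Proof.
apply: (iffP imsetP) => [[i _ ->]|[i ltiv ->]]; first by exists (val i); rewrite ?ltn_ord.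
by exists (Ordinal ltiv).
Qed.

Lemma ancestors_refl v : v != rt -> v \in ancestors v.
Proof. by rewrite -depth_eq0 -lt0n => v0; apply/ancestorsP; exists 0. Qed.

Lemma ancestors_neq_root f v : f \in ancestors v -> f != rt.
Proof.
by case/ancestorsP=> i ltiv ->; rewrite -depth_eq0 depth_iter subn_eq0 -ltnNge.
Qed.

Lemma ancestors_trans f g v :
  f \in ancestors g -> g \in ancestors v -> f \in ancestors v.
Proof.
case/ancestorsP=> i ltig -> /ancestorsP[j ltjv eg].
move: ltig; rewrite eg depth_iter => ltig; apply/ancestorsP.
by exists (i + j); [lia | rewrite iterD].
Qed.

Lemma ancestors_iter f v :
  f \in ancestors v -> iter (dep v - dep f) par v = f.
Proof.
case/ancestorsP=> i ltiv ->; congr iter; rewrite depth_iter; lia.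
Qed.

Lemma depth_ancestors f v : f \in ancestors v -> dep f <= dep v.
Proof. by case/ancestorsP=> i _ ->; rewrite depth_iter leq_subr. Qed.

Lemma depth_ancestors_lt f v : f \in ancestors v -> f != v -> dep f < dep v.
Proof.
move=> fv; apply: contraNltn => le_vf; rewrite -(ancestors_iter fv).
by move: le_vf; rewrite -subn_eq0 => /eqP->.
Qed.

Lemma iter_ancestors i v : i < dep v -> iter i par v \in ancestors v.
Proof. by move=> lti; apply/ancestorsP; exists i. Qed.

Lemma ancestors_comparable f g v : f \in ancestors v -> g \in ancestors v ->
  dep f <= dep g -> f \in ancestors g.
Proof.
move=> fv gv lefg; have f0 := ancestors_neq_root fv.
rewrite -depth_eq0 in f0.
have legv := depth_ancestors gv.
rewrite -(ancestors_iter fv).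
have ->: dep v - dep f = (dep g - dep f) + (dep v - dep g) by lia.
rewrite iterD (ancestors_iter gv); apply: iter_ancestors; lia.
Qed.

Lemma card_ancestors_le v k : k <= dep v ->
  #|[set f in ancestors v | dep f <= k]| = k.
Proof.
move=> lekv.
have inj : injective (fun i : 'I_k => iter (dep v - i.+1) par v).
  move=> i j /(congr1 dep); rewrite !depth_iter => e; apply: val_inj => /=.
  by have := ltn_ord i; have := ltn_ord j; lia.
rewrite -[RHS](card_ord k) -(card_imset _ inj); apply: eq_card => f.
rewrite !inE; apply/andP/imsetP => [[fv lefk]|[i _ ->]].
  have f0 := ancestors_neq_root fv; rewrite -depth_eq0 in f0.
  have ltk : (dep f).-1 < k by lia.
  exists (Ordinal ltk) => //=; rewrite prednK ?lt0n //.
  by rewrite ancestors_iter.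
have ltik := ltn_ord i; rewrite depth_iter; split; last by lia.
by apply: iter_ancestors; lia.
Qed.

Lemma card_ancestors v : #|ancestors v| = dep v.
Proof.
rewrite -[RHS](card_ancestors_le (leqnn (dep v))); apply: eq_card => f.
by rewrite !inE andb_idr // => /depth_ancestors.
Qed.

Lemma ancestor_at_depth v k : 0 < k <= dep v ->
  exists2 f, f \in ancestors v & dep f = k.
Proof.
move=> kv; exists (iter (dep v - k) par v); last by rewrite depth_iter; lia.
by apply: iter_ancestors; lia.
Qed.

Lemma ancestorsS v : v != rt -> ancestors v = v |: ancestors (par v).
Proof.
move=> v0; have dv := depth_parent v0; apply/setP=> f; rewrite in_setU1.
apply/ancestorsP/orP => [[[|i] lti ->]|[/eqP->|/ancestorsP[i lti ->]]].
- by left.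
- by right; rewrite iterSr; apply: iter_ancestors; lia.
- by exists 0; rewrite ?dv.
- by exists i.+1; rewrite ?iterSr // dv.
Qed.

Lemma depth_lt_card v : dep v < #|V|.
Proof.
rewrite -card_ancestors; apply: proper_card; apply/properP; split.
  exact: subset_predT.
by exists rt => //; apply: contraTN (eqxx rt) => /ancestors_neq_root.
Qed.

Definition height (v : V) : nat :=
  \max_(g | v \in ancestors g) (dep g - dep v).

Lemma depth_le_height v g : v \in ancestors g -> dep g <= dep v + height v.
Proof.
move=> vg; have := @leq_bigmax_cond _ (fun g => v \in ancestors g)
  (fun g => dep g - dep v) g vg.
rewrite -/(height v); lia.
Qed.

Lemma height_attained v : v != rt ->
  exists2 g, v \in ancestors g & dep g = dep v + height v.
Proof.
move=> v0; have vv := ancestors_refl v0.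
have [g vg e] := eq_bigmax_cond (fun g => dep g - dep v)
  (ltac:(apply/card_gt0P; exists v; exact: vv) : 0 < #|[pred g | v \in ancestors g]|).
exists g => //; have := depth_ancestors vg.
have -> : height v = dep g - dep v by rewrite -e; apply: eq_bigl.
lia.
Qed.

Lemma height_lt_card v : height v < #|V|.
Proof.
rewrite /height; apply: (@leq_ltn_trans (#|V|.-1)).
  by apply/bigmax_leqP => g _; have := depth_lt_card g; lia.
by rewrite prednK //; apply/card_gt0P; exists v.
Qed.

Lemma height_ancestors f g :
  f \in ancestors g -> dep g + height g <= dep f + height f.
Proof.
move=> fg; have [|q gq <-] := height_attained (v := g).
  by apply: contraTneq fg => ->; apply/ancestorsP=> -[i]; rewrite depth_root.
exact: depth_le_height (ancestors_trans fg gq).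
Qed.

(** Heights drop by exactly one along a longest descending path, so that all
    smaller heights occur below [v]. *)
Lemma descendant_of_height v k : v != rt -> k <= height v ->
  exists2 g, v \in ancestors g & height g = k.
Proof.
move=> v0 lek; have [q vq eq] := height_attained v0.
have dv : 0 < dep v by rewrite lt0n depth_eq0.
have [|g gq eg] := @ancestor_at_depth q (dep v + (height v - k)); first by lia.
have vg : v \in ancestors g by apply: ancestors_comparable vq gq _; lia.
exists g => //; have := depth_le_height gq; have := height_ancestors vg; lia.
Qed.

End Ancestors.

(** * The embedding order and the guarded directions *)

Section Schedule.

Variables (V : finType) (R : rooted_tree V) (l : V).

Local Notation rt := (tree_root R).
Local Notation par := (parent R).
Local Notation dep := (depth R).
Local Notation anc := (ancestors R).
Local Notation ht := (@height _ R).

(** Sorts by [depth - height], shifted to stay nonnegative, with ties broken by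
    [enum_rank]; the leaf [l] is put after everything else. *)
Definition clock (v : V) : nat :=
  if v == l then (#|V|.*2 * #|V|)
  else (dep v + (#|V| - ht v)) * #|V| + enum_rank v.

Lemma clock_lt_leaf v : v != l -> clock v < clock l.
Proof.
rewrite /clock eqxx => /negPf->.
have := ltn_ord (enum_rank v); have := depth_lt_card R v.
move: (nat_of_ord _) => k; move: (dep v) (ht v) #|V| => a b c; nia.
Qed.

Lemma clock_inj : injective clock.
Proof.
move=> u v; have [->|ul] := eqVneq u l.
  by have [->|/clock_lt_leaf lt e] // := eqVneq v l; rewrite e ltnn in lt.
have [->|vl] := eqVneq v l.
  by move=> e; have := clock_lt_leaf ul; rewrite e ltnn.
rewrite /clock (negPf ul) (negPf vl) => /(congr1 (modn^~ #|V|)).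
rewrite !modnMDl !modn_small ?ltn_ord // => e.
exact/enum_rank_inj/val_inj.
Qed.

Lemma clock_le_key u v : u != l -> v != l -> clock u <= clock v ->
  dep u + ht v <= dep v + ht u.
Proof.
rewrite /clock => /negPf-> /negPf->.
have := ltn_ord (enum_rank u); have := ltn_ord (enum_rank v).
move: (nat_of_ord _) (nat_of_ord _) => i j.
have := height_lt_card R u; have := height_lt_card R v.
move: (dep u) (ht u) (dep v) (ht v) #|V| => a b c d n; nia.
Qed.

Lemma clock_lt_key u v : u != l -> v != l ->
  dep u + ht v < dep v + ht u -> clock u < clock v.
Proof.
by move=> ul vl; rewrite !ltnNge; apply: contra; apply: clock_le_key.
Qed.

Hypothesis l_neq_root : l != rt.
Hypothesis parent_l : par l = rt.
Hypothesis l_childless : forall v, v != rt -> par v != l.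

Lemma depth_l : dep l = 1.
Proof. by rewrite depth_parent // parent_l depth_root. Qed.

Lemma leaf_ancestors v : l \in anc v -> v = l.
Proof.
case/ancestorsP=> -[|i] lti // e.
have iv0 : iter i par v != rt by rewrite -depth_eq0 depth_iter; nat_lia.
by have := l_childless iv0; rewrite e eqxx.
Qed.

Lemma clock_ancestors f e : f \in anc e -> f != e -> clock f < clock e.
Proof.
move=> fe f_e; have f_l : f != l.
  by apply: contraNneq f_e => fl; rewrite fl in fe *; rewrite (leaf_ancestors fe).
have [->|el] := eqVneq e l; first exact: clock_lt_leaf.
apply: clock_lt_key => //.
have := depth_ancestors_lt fe f_e; have := height_ancestors fe; nat_lia.
Qed.

Definition later (e : V) : {set V} :=
  [set g | (g != rt) && (clock e < clock g)].

(** The edge whose direction [e] avoids on account of the later edge [g].  In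
    the last case the two edges branch at the vertex of depth
    [#|anc g :&: anc e|]; the truncated [iter] climbs from [g] to a prescribed
    depth. *)
Definition guard (e g : V) : V :=
  if g == l then iter (ht e).+2 par e
  else if e \in anc g then iter (ht g).+2 par e
  else iter (dep g - (#|anc g :&: anc e| + (ht g).+1)) par g.

Definition guarded (e : V) : {set V} := guard e @: later e.

(** The point of letting the later edges buy the forbidden directions one by
    one: the bound on their number needs no counting argument. *)
Lemma card_guarded e : #|guarded e| <= #|later e|.
Proof. exact: leq_imset_card. Qed.

Definition incident (e f : V) : bool := (par e == f) || (par e == par f).


Section Branches.

Variables u w : V.

Let c := #|anc u :&: anc w|.

(** The ancestors of [u] form a chain whose initial segment, down to the depth
    of the branching point, is shared with [w]. *)
Lemma common_ancestorsE f : f \in anc u -> (f \in anc w) = (dep f <= c).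
Proof.
move=> fu; apply/idP/idP => [fw|].
  rewrite -(card_ancestors R f); apply/subset_leq_card/subsetP=> q qf.
  by rewrite inE !(ancestors_trans qf).
apply: contraLR => fw; rewrite -ltnNge -(card_ancestors R f).
apply/proper_card/properP; split; last first.
  exists f; first exact: ancestors_refl (ancestors_neq_root fu).
  by rewrite inE fu (negPf fw).
apply/subsetP=> q; rewrite inE => /andP[qu qw].
case/orP: (leq_total (dep q) (dep f)) => le_qf.
  exact: ancestors_comparable qu fu le_qf.
by rewrite (ancestors_trans (ancestors_comparable fu qu le_qf) qw) in fw.
Qed.

Lemma depth_common : c <= dep u.
Proof. by rewrite -(card_ancestors R u); apply/subset_leq_card/subsetIl. Qed.

Lemma mem_branch f : (f \in anc u :\: anc w) = (f \in anc u) && (c < dep f).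
Proof.
by rewrite inE andbC; case fu: (f \in anc u) => //=; rewrite common_ancestorsE // ltnNge.
Qed.

Lemma card_branch_le k : c <= k <= dep u ->
  #|[set f in anc u :\: anc w | dep f <= k]| = k - c.
Proof.
case/andP=> le_ck le_ku; have le_cu := leq_trans le_ck le_ku.
transitivity (#|[set f in anc u | dep f <= k] :\: [set f in anc u | dep f <= c]|).
  apply: eq_card => f; rewrite inE mem_branch !inE ltnNge.
  by case: (f \in anc u); rewrite ?andbF.
rewrite cardsDS ?card_ancestors_le //.
by apply/subsetP=> f; rewrite !inE => /andP[-> /leq_trans->].
Qed.

Lemma card_branch : #|anc u :\: anc w| = dep u - c.
Proof. by rewrite cardsD card_ancestors. Qed.

Lemma branch_meet f e : f \in anc u :\: anc w -> e \in anc w :\: anc u ->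
  anc f :&: anc e = anc u :&: anc w.
Proof.
rewrite !inE => /andP[fw fu] /andP[eu ew]; apply/setP=> q; rewrite !inE.
apply/andP/andP=> [[qf qe]|[qu qw]].
  by rewrite (ancestors_trans qf) // (ancestors_trans qe).
split.
  case/orP: (leq_total (dep q) (dep f)) => le_qf.
    exact: ancestors_comparable qu fu le_qf.
  by rewrite (ancestors_trans (ancestors_comparable fu qu le_qf) qw) in fw.
case/orP: (leq_total (dep q) (dep e)) => le_qe.
  exact: ancestors_comparable qw ew le_qe.
by rewrite (ancestors_trans (ancestors_comparable ew qw le_qe) qu) in eu.
Qed.

End Branches.

(** The edges of the path between [u] and [w]. *)
Definition branches (u w : V) : {set V} :=
  (anc u :\: anc w) :|: (anc w :\: anc u).

Lemma branchesC u w : branches u w = branches w u.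
Proof. by rewrite /branches setUC. Qed.

Lemma card_branches u w :
  #|branches u w| = #|anc u :\: anc w| + #|anc w :\: anc u|.
Proof.
rewrite cardsU -[RHS]subn0; congr (_ - _); apply/eqP; rewrite cards_eq0.
by apply/eqP/setP=> f; rewrite !inE; case: (f \in anc u); case: (f \in anc w).
Qed.

Section Directions.

Variables (D : eqType) (dir : V -> D).

Hypothesis dir_guarded : forall e f, e != rt -> f != rt ->
  clock f < clock e -> (f \in guarded e) || incident e f -> dir e != dir f.

(** Descending paths.  The edges below [e] have all heights below [height e],
    and all come later: they buy the ancestors 2 to [height e + 1] steps up.
    The leaf [l] buys the ancestor [height e + 2] steps up, which is what makes
    paths with two odd sides work; the parent is incident to [e]. *)
Lemma dir_ancestors e f : f \in anc e -> f != e -> e != l ->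
  dep e <= dep f + (ht e).+2 -> dir e != dir f.
Proof.
move=> fe f_e el le_ef.
have e0 : e != rt.
  by apply: contraTneq fe => ->; apply/ancestorsP=> -[i]; rewrite depth_root.
have lt_ef := depth_ancestors_lt fe f_e.
apply: dir_guarded => //; first exact: ancestors_neq_root fe.
  exact: clock_ancestors.
have efe := ancestors_iter fe.
have [d1|d1] := eqVneq (dep e) (dep f).+1.
  apply/orP; right; apply/orP; left.
  by move: efe; rewrite d1 subSn // subnn => /eqP.
apply/orP; left; apply/imsetP.
have [d2|d2] := eqVneq (dep e) (dep f + (ht e).+2).
  exists l; first by rewrite inE l_neq_root clock_lt_leaf.
  by rewrite /guard eqxx -{1}efe; congr iter; lia.
have [|g eg hg] := @descendant_of_height _ R e (dep e - (dep f).+2) e0; first by lia.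
have g_e : e != g by apply/eqP=> eq_eg; rewrite -eq_eg in hg; lia.
have gl : g != l.
  apply/eqP=> gl; have := depth_ancestors_lt eg g_e.
  by rewrite gl depth_l ltnS leqn0 depth_eq0 (negPf e0).
exists g; first by rewrite inE (clock_ancestors eg) // -depth_eq0; have := depth_ancestors eg; lia.
by rewrite /guard (negPf gl) eg hg -{1}efe; congr iter; lia.
Qed.

(** Edges on different branches: [e] avoids the direction of [f] as soon as some
    later edge below [f] has the height that matches the depth of [f] under the
    branching point. *)
Lemma dir_cross e f g : e != rt -> e \notin anc f -> f \notin anc e ->
  clock f < clock e -> f \in anc g -> clock e < clock g -> f != g -> 
  dep f = #|anc f :&: anc e| + (ht g).+1 -> dir e != dir f.
Proof.
move=> e0 ef fe lt_fe fg lt_eg f_g df.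
have f0 := ancestors_neq_root fg.
have gl : g != l.
  apply/eqP=> gl; have := depth_ancestors_lt fg f_g.
  by rewrite gl depth_l ltnS leqn0 depth_eq0 (negPf f0).
have eg : e \notin anc g.
  apply/negP=> eg; case/orP: (leq_total (dep e) (dep f)) => le_ef.
    by rewrite (ancestors_comparable eg fg le_ef) in ef.
  by rewrite (ancestors_comparable fg eg le_ef) in fe.
have common : anc g :&: anc e = anc f :&: anc e.
  apply/setP=> q; rewrite !inE andbC [RHS]andbC; case qe: (q \in anc e) => //=.
  apply/idP/idP => [qg|qf]; last exact: ancestors_trans fg.
  case/orP: (leq_total (dep q) (dep f)) => le_qf.
    exact: ancestors_comparable qg fg le_qf.
  have fq := ancestors_comparable fg qg le_qf.
  by rewrite (ancestors_trans fq qe) in fe.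
apply: dir_guarded => //; apply/orP; left; apply/imsetP; exists g.
  rewrite inE lt_eg andbT -depth_eq0; have := depth_ancestors fg; lia.
by rewrite /guard (negPf gl) (negPf eg) common -df ancestors_iter.
Qed.

(** The heart of the argument.  Here [a] is the edge at position [uphalf x + 1]
    on the side of [u], assumed to come before its counterpart, if any, on the
    side of [w].

    On either side the edge at position [i] has height at least the length of
    the side minus [i], and [dir_ancestors] applies.  If [f] on the side of [u]
    comes before [e] on the side of [w], then [e] is in the upper half of its
    side, hence [depth - height], with depths counted from the branching point,
    is at most 0 for [e] and so also for [f]; every edge strictly below [f] of
    height [depth f - 1] then has [depth - height] at least 2 and comes after
    [e].  If [f] on the side of [w] comes before [e] on the side of [u], then
    the counterpart [b] of [a] comes after [a], hence after [e], and the edges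
    from [b] downwards supply the required height. *)
Lemma dir_inj_on_halves u w a :
    let c := #|anc u :&: anc w| in
    let x := #|anc u :\: anc w| in let y := #|anc w :\: anc u| in
    odd x = odd y -> a \in anc u :\: anc w -> dep a = (c + uphalf x).+1 ->
    (forall b, b \in anc w :\: anc u -> dep b = (c + uphalf y).+1 ->
       clock a < clock b) ->
  exists S : {set V}, [/\ S \subset branches u w, {in S &, injective dir}
                        & #|branches u w| < #|S|.*2].
Proof.
move=> c x y odd_xy aA da lt_ab.
have cC : #|anc w :&: anc u| = c by rewrite setIC.
have dx : dep u = c + x.
  by rewrite /x card_branch -/c subnKC // depth_common.
have dy : dep w = c + y.
  by rewrite /y card_branch cC subnKC // -cC depth_common.
have [au ac] : a \in anc u /\ c < dep a by apply/andP; rewrite -mem_branch.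
have le_au := depth_ancestors au.
pose SA := [set f in anc u :\: anc w | dep f <= dep a].
pose SB := [set f in anc w :\: anc u | dep f <= c + y./2].
have SAP f : f \in SA -> [/\ f \in anc u, c < dep f & dep f <= dep a].
  by rewrite inE mem_branch -/c => /andP[/andP[]].
have SBP f : f \in SB -> [/\ f \in anc w, c < dep f & dep f <= c + y./2].
  by rewrite inE mem_branch cC => /andP[/andP[]].
have SA_l f : f \in SA -> f != l.
  case/SAP=> fu _ _; apply/eqP=> fl; rewrite fl in fu.
  have := leaf_ancestors fu => ul; have := depth_l; rewrite -ul; nat_lia.
have SB_l f : f \in SB -> f != l.
  case/SBP=> fw cf fy; apply/eqP=> fl; rewrite fl in fw.
  have := leaf_ancestors fw => wl; have := depth_l; rewrite -wl; nat_lia.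
have later_below v f e : f \in anc v -> e \in anc v -> clock f < clock e ->
    f \in anc e.
  move=> fv ev lt_fe; case/orP: (leq_total (dep f) (dep e)) => le_fe.
    exact: ancestors_comparable fv ev le_fe.
  have ef := ancestors_comparable ev fv le_fe.
  have [->|e_f] := eqVneq f e; first exact: ancestors_refl (ancestors_neq_root ev).
  by have := clock_ancestors ef; rewrite eq_sym e_f => /(_ isT); nat_lia.
have neq f e : f \in SA :|: SB -> e \in SA :|: SB -> clock f < clock e ->
    dir e != dir f.
  move=> fS eS lt_fe; have f_e : f != e by apply: contraTneq lt_fe => ->; rewrite ltnn.
  have cross f1 e1 : f1 \in SA -> e1 \in SB ->
      [/\ e1 \notin anc f1, f1 \notin anc e1 & #|anc f1 :&: anc e1| = c].
    move=> fA eB; have fA' : f1 \in anc u :\: anc w by case/setIdP: fA.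
    have eB' : e1 \in anc w :\: anc u by case/setIdP: eB.
    rewrite (branch_meet fA' eB'); move: fA' eB'; rewrite !inE.
    case/andP=> fw fu /andP[eu ew]; split=> //.
      by apply: contra eu => /ancestors_trans; apply.
    by apply: contra fw => /ancestors_trans; apply.
  (* In each case [f] is the earlier edge and [e] the later one. *)
  case/setUP: fS => fS; case/setUP: eS => eS.
  - have [fu cf fa] := SAP f fS; have [eu ce ea] := SAP e eS.
    apply: dir_ancestors => //; [exact: later_below eu lt_fe | exact: SA_l |].
    have := depth_le_height eu; nat_lia.
  (* [f] above [u] and [e] above [w]: compare [depth - height]. *)
  - have [fu cf fa] := SAP f fS; have [ew ce ey] := SBP e eS.
    have [ef fe meet] := cross f e fS eS.
    have fl := SA_l f fS; have el := SB_l e eS.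
    have key := clock_le_key fl el (ltnW lt_fe).
    have he := depth_le_height ew.
    have f0 := ancestors_neq_root fu.
    have [|g fg hg] := @descendant_of_height _ R f (dep f - c).-1 f0; first by nat_lia.
    have f_g : f != g by apply/eqP=> eq_fg; rewrite -eq_fg in hg; nat_lia.
    have dfg := depth_ancestors_lt fg f_g.
    apply: (dir_cross _ ef fe lt_fe fg) => //.
    + exact: ancestors_neq_root ew.
    + apply: clock_lt_key => //; last by nat_lia.
      by apply/eqP=> gl; have := depth_l; rewrite -gl; nat_lia.
    + by rewrite meet; nat_lia.
  (* [f] above [w] and [e] above [u]: descend from the counterpart [b] of [a],
     which exists because [f] is in the top half of its side. *)
  - have [fw cf fy] := SBP f fS; have [eu ce ea] := SAP e eS.
    have [fe ef] := cross e f eS fS; rewrite setIC => meet.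
    have [|b bw db] := @ancestor_at_depth _ R w (c + uphalf y).+1; first by nat_lia.
    have lt_ab' : clock a < clock b by apply: lt_ab; rewrite ?mem_branch ?cC ?bw //; nat_lia.
    have b0 := ancestors_neq_root bw.
    have hb := depth_le_height bw.
    have [|g bg hg] := @descendant_of_height _ R b (dep f - c).-1 b0; first by nat_lia.
    have fb : f \in anc b by apply: ancestors_comparable fw bw _; nat_lia.
    have fg := ancestors_trans fb bg.
    have dbg := depth_ancestors bg.
    apply: (dir_cross _ ef fe lt_fe fg).
    + exact: ancestors_neq_root eu.
    + have le_ea : clock e <= clock a.
        have [->//|e_a] := eqVneq e a.
        by apply/ltnW/clock_ancestors => //; apply: ancestors_comparable eu au _.
      have le_bg : clock b <= clock g.
        by have [->//|b_g] := eqVneq b g; apply/ltnW/clock_ancestors.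
      nat_lia.
    + by apply/eqP=> eq_fg; rewrite eq_fg in fy; nat_lia.
    + by rewrite meet; nat_lia.
  - have [fw cf fy] := SBP f fS; have [ew ce ey] := SBP e eS.
    apply: dir_ancestors => //; [exact: later_below ew lt_fe | exact: SB_l |].
    have := depth_le_height ew; nat_lia.
exists (SA :|: SB); split.
- by apply: setUSS; apply/subsetP=> f /setIdP[].
- move=> f e fS eS eq_dir; apply: clock_inj.
  case: (ltngtP (clock f) (clock e)) => // /neq.
    by move=> /(_ fS eS); rewrite eq_dir eqxx.
  by move=> /(_ eS fS); rewrite eq_dir eqxx.
- rewrite card_branches -/x -/y cardsU.
  have -> : SA :&: SB = set0.
    by apply/setP=> f; rewrite !inE; case: (f \in anc u); case: (f \in anc w); rewrite ?andbF.
  rewrite cards0 card_branch_le -/c; last by nat_lia.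
  rewrite card_branch_le cC; last by nat_lia.
  by nat_lia.
Qed.

(** If both sides have length at most 1, the path consists of two sibling edges;
    otherwise at least one side has an edge at position [uphalf + 1], and the
    earliest such edge decides which side gets the longer share. *)
Lemma dir_inj_on_majority u w : u != w -> ~~ odd #|branches u w| ->
  exists S : {set V}, [/\ S \subset branches u w, {in S &, injective dir}
                        & #|branches u w| < #|S|.*2].
Proof.
move=> u_w; pose c := #|anc u :&: anc w|.
pose x := #|anc u :\: anc w|; pose y := #|anc w :\: anc u|.
have cC : #|anc w :&: anc u| = c by rewrite setIC.
have dx : dep u = c + x.
  by rewrite /x card_branch -/c subnKC // depth_common.
have dy : dep w = c + y.
  by rewrite /y card_branch cC subnKC // -cC depth_common.
rewrite {1}card_branches -/x -/y oddD negb_add => /eqP odd_xy.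
have xy0 : 0 < x + y.
  rewrite lt0n -card_branches cards_eq0; apply: contraNneq u_w => P0.
  have anc_uw : anc u = anc w.
    apply/setP=> f; move/setP/(_ f): P0; rewrite !inE.
    by case: (f \in anc u); case: (f \in anc w).
  have [u0|/ancestors_refl] := eqVneq u rt.
    by rewrite u0 eq_sym -depth_eq0 -card_ancestors -anc_uw card_ancestors u0 depth_root.
  rewrite anc_uw => uw; rewrite -(ancestors_iter uw).
  by rewrite -!card_ancestors anc_uw subnn.
have lt_fresh v v' (b b' : V) : b \in anc v :\: anc v' -> b' \in anc v' :\: anc v ->
    (clock b' < clock b) = ~~ (clock b < clock b').
  move=> bB bB'; rewrite -leqNgt ltn_neqAle andb_idl // => _.
  rewrite (inj_eq clock_inj); apply: contraTneq bB => <-.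
  by move: bB'; rewrite !inE => /andP[/negPf-> ->].
have unique_at v b b' : b \in anc v -> b' \in anc v -> dep b = dep b' -> b = b'.
  by move=> bv bv' e; rewrite -(ancestors_iter bv) -(ancestors_iter bv') e.
have [x1|x1] := leqP x 1; have [y1|y1] := leqP y 1.
- have [x_1 y_1] : x = 1 /\ y = 1 by nat_lia.
  have sib : par u = par w.
    have dpu : dep (par u) = c by have := depth_iter R 1 u; rewrite /= dx; nat_lia.
    have [c0|c0] := posnP c.
      have dpw : dep (par w) = c by have := depth_iter R 1 w; rewrite /= dy; nat_lia.
      apply/eqP; move/eqP: dpu dpw; rewrite c0 depth_eq0 => /eqP-> /eqP.
      by rewrite depth_eq0 eq_sym.
    have pu : par u \in anc u by apply: (@iter_ancestors _ R 1 u); nat_lia.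
    have pw : par u \in anc w by rewrite (common_ancestorsE _ pu) dpu.
    have := ancestors_iter pw; rewrite dpu dy y_1.
    by rewrite -addnBAC // subnn.
  have u0 : u != rt by rewrite -depth_eq0; nat_lia.
  have w0 : w != rt by rewrite -depth_eq0; nat_lia.
  have dir_uw : dir u != dir w.
    case: (ltngtP (clock u) (clock w)) => [lt|lt|/clock_inj e]; last by rewrite e eqxx in u_w.
      by rewrite eq_sym; apply: dir_guarded => //; rewrite /incident sib eqxx !orbT.
    by apply: dir_guarded => //; rewrite /incident sib eqxx !orbT.
  exists (branches u w); split=> //; last by rewrite card_branches -/x -/y x_1 y_1.
  have sub f : f \in branches u w -> f = u \/ f = w.
    case/setUP; rewrite mem_branch ?cC -/c => /andP[fv cf].
      have le_f := depth_ancestors fv.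
      by left; apply: (unique_at _ _ _ fv); [exact: ancestors_refl | nat_lia].
    have le_f := depth_ancestors fv.
    by right; apply: (unique_at _ _ _ fv); [exact: ancestors_refl | nat_lia].
  move=> f g /sub[]-> /sub[]-> // e; first by rewrite e eqxx in dir_uw.
  by rewrite e eqxx in dir_uw.
- have [|b bw db] := @ancestor_at_depth _ R w (c + uphalf y).+1; first by nat_lia.
  rewrite branchesC; apply: (@dir_inj_on_halves w u b); rewrite ?mem_branch ?cC ?bw //=.
    by nat_lia.
  by move=> a; rewrite mem_branch -/c -/x => /andP[/depth_ancestors]; nat_lia.
- have [|a au da] := @ancestor_at_depth _ R u (c + uphalf x).+1; first by nat_lia.
  apply: (@dir_inj_on_halves u w a); rewrite ?mem_branch ?au //=.
    by rewrite -/c; nat_lia.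
  by move=> b; rewrite mem_branch cC -/y => /andP[/depth_ancestors]; rewrite -/c; nat_lia.
- have [|b bw db] := @ancestor_at_depth _ R w (c + uphalf y).+1; first by nat_lia.
  have [|a au da] := @ancestor_at_depth _ R u (c + uphalf x).+1; first by nat_lia.
  have aA : a \in anc u :\: anc w by rewrite mem_branch au -/c da; nat_lia.
  have bB : b \in anc w :\: anc u by rewrite mem_branch cC bw db; nat_lia.
  have [lt_ab|] := boolP (clock a < clock b).
    apply: (@dir_inj_on_halves u w a) => // b' /setDP[b'w _] db'.
    by rewrite (unique_at w b' b) // db db'.
  rewrite -(lt_fresh _ _ _ _ aA bB) => lt_ba; rewrite branchesC.
  apply: (@dir_inj_on_halves w u b); rewrite ?cC // => a' /setDP[a'u _] da'.
  by rewrite (unique_at u a' a) // da da'.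
Qed.

End Directions.

End Schedule.

(** * Greedy rainbow embedding *)

Lemma adjC (U : finType) (G : sgraph U) x y : adj G x y = adj G y x.
Proof. by rewrite /adj setUC. Qed.

Lemma adj_verts (U : finType) (G : sgraph U) x y : adj G x y -> y \in verts G.
Proof.
move=> xy; have /forall_inP/(_ _ xy)/andP[/subsetP sub _] := edgesP G.
by apply: sub; rewrite !inE eqxx orbT.
Qed.

Lemma adj_neq (U : finType) (G : sgraph U) x y : adj G x y -> x != y.
Proof.
move=> xy; have /forall_inP/(_ _ xy)/andP[_] := edgesP G.
by rewrite cards2; case: (x != y).
Qed.

Lemma min_degree_le (U : finType) (G : sgraph U) x :
  x \in verts G -> min_degree G <= degree G x.
Proof.
rewrite /min_degree => xG; elim: index_enum (mem_index_enum x) => // y s IHs.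
rewrite inE big_cons => /predU1P[<-|/IHs le_x]; first by rewrite xG geq_minl.
by case: ifP => // _; apply: leq_trans (geq_minr _ _) le_x.
Qed.

(** Counting used colours requires a type with decidable equality, which an
    arbitrary type of colours is not.  A colour is replaced by a canonical edge
    that carries it. *)
Lemma coloring_code (U : finType) (G : sgraph U) (C : Type) (c : edge G -> C) :
  exists (K : finType) (k : {set U} -> K),
    forall e f : edge G, k (val e) = k (val f) <-> c e = c f.
Proof.
pose E : finType := {e : {set U} | e \in edges G}.
pose same (e f : E) : bool := if excluded_middle_informative (c e = c f) then true else false.
have sameP e f : reflect (c e = c f) (same e f).
  by rewrite /same; case: excluded_middle_informative => ?; constructor.
pose rep (e : E) := [pick f | same e f].
exists (option E), (fun A => obind rep (insub A)) => e f; rewrite !valK /=.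
split=> [|ef]; last by apply: eq_pick => g; apply/sameP/sameP; rewrite ef.
rewrite /rep; case: pickP => [g /sameP eg|/(_ e)/sameP[] //].
by case: pickP => // h /sameP fh [gh]; rewrite eg fh gh.
Qed.

Section Greedy.

Variables (V : finType) (R : rooted_tree V) (l : V).
Hypothesis l_childless : forall v, v != tree_root R -> parent R v != l.

Local Notation rt := (tree_root R).
Local Notation par := (parent R).
Local Notation clk := (clock R l).
Local Notation guarded := (guarded R l).

Lemma parent_clock v : v != rt -> par v != rt -> clk (par v) < clk v.
Proof.
move=> v0 pv0; have pv : par v \in ancestors R v.
  apply: (@iter_ancestors _ R 1 v).
  by rewrite (depth_parent v0) ltnS lt0n depth_eq0.
apply: clock_ancestors => //; apply/eqP => e.
by have := depth_parent v0; rewrite e; lia.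
Qed.

Variables (X : finZmodType) (G : sgraph X) (K : finType) (k : {set X} -> K).

Hypothesis k_proper : forall p y y', adj G p y -> adj G p y' ->
  k [set y; p] = k [set y'; p] -> y = y'.
Hypothesis G_degree : forall p, p \in verts G -> #|V|.-1 <= degree G p.

Definition edge_image (phi : V -> X) v : {set X} := [set phi v; phi (par v)].
Definition step (phi : V -> X) v : X := (phi v - phi (par v))%R.

(** Only the edges of clock value below [m] count as embedded; [phi] takes
    arbitrary values elsewhere. *)
Definition partial_embedding v0 m phi :=
  [/\ phi rt = v0,
      forall v, v != rt -> clk v < m -> adj G (phi (par v)) (phi v),
      forall e f, e != rt -> f != rt -> clk f < clk e -> clk e < m ->
        k (edge_image phi e) != k (edge_image phi f)
    & forall e f, e != rt -> f != rt -> clk f < clk e -> clk e < m ->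
        f \in guarded e -> step phi e != step phi f].

Lemma earlier_later e : e != rt ->
  #|[set f | (f != rt) && (clk f < clk e)]| + #|later R l e| < #|V|.-1.
Proof.
move=> e0; rewrite -(cardC1 rt); rewrite -addnS.
have -> : #|later R l e|.+1 = #|e |: later R l e|.
  by rewrite cardsU1 inE ltnn andbF.
rewrite -[X in X <= _]subn0 -(cards0 V).
have <- : [set f | (f != rt) && (clk f < clk e)] :&: (e |: later R l e) = set0.
  apply/setP=> f; rewrite !inE; have [->|_] := eqVneq f e; first by rewrite ltnn andbF.
  by case: (f != rt) => //=; case: ltngtP.
rewrite -cardsU; apply: subset_leq_card; apply/subsetP=> f.
by rewrite !inE => /orP[/andP[]|/orP[/eqP->|/andP[]]].
Qed.

(** The greedy step: used colours block at most as many neighbours as there are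
    earlier edges, guarded directions at most as many as there are later ones,
    and the new edge itself is counted in neither. *)
Lemma partial_embeddingS v0 m phi : v0 \in verts G ->
  partial_embedding v0 m phi -> exists phi', partial_embedding v0 m.+1 phi'.
Proof.
move=> v0G [phi_rt phi_adj phi_col phi_step].
have [e /andP[e0 /eqP em]|no_e] := pickP [pred e | (e != rt) && (clk e == m)]; last first.
  have lt_m v : v != rt -> clk v < m.+1 -> clk v < m.
    move=> v0'; rewrite ltnS leq_eqVlt => /orP[vm|//].
    by have := no_e v; rewrite /= v0' vm.
  exists phi; split=> // [v v0' /(lt_m _ v0')|e f e0 f0 fe /(lt_m _ e0)|e f e0 f0 fe /(lt_m _ e0)].
  - exact: phi_adj.
  - exact: phi_col.
  - exact: phi_step.
pose p := phi (par e).
have pG : p \in verts G.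
  have [pe|pe] := eqVneq (par e) rt; first by rewrite /p pe phi_rt.
  by apply: adj_verts (phi_adj _ pe _); rewrite -em; apply: parent_clock.
pose earlier := [set f | (f != rt) && (clk f < clk e)].
pose used := [set k (edge_image phi f) | f in earlier].
pose nbrs := [set y in verts G | adj G p y].
pose bad1 := [set y in nbrs | k [set y; p] \in used].
pose bad2 := [set (p + step phi f)%R | f in guarded e].
have le_bad1 : #|bad1| <= #|earlier|.
  have inj1 : {in bad1 &, injective (fun y => k [set y; p])}.
    move=> y y'; rewrite !inE => /andP[/andP[_ py] _] /andP[/andP[_ py'] _].
    exact: k_proper.
  rewrite -(card_in_imset inj1).
  apply: leq_trans (leq_imset_card (fun f => k (edge_image phi f)) _).
  by apply/subset_leq_card/subsetP=> _ /imsetP[y /setIdP[_ ky] ->].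
have le_bad2 : #|bad2| <= #|later R l e|.
  exact: leq_trans (leq_imset_card _ _) (card_guarded R l e).
have /card_gt0P[y] : 0 < #|nbrs :\: (bad1 :|: bad2)|.
  rewrite cardsD subn_gt0.
  apply: leq_ltn_trans (subset_leq_card (subsetIr _ _)) _.
  apply: leq_ltn_trans (leq_card_setU _ _) _.
  apply: leq_ltn_trans (leq_add le_bad1 le_bad2) _.
  exact: leq_trans (earlier_later e0) (G_degree pG).
rewrite 2!inE negb_or => /andP[/andP[y1 y2] ynb].
have py : adj G p y by move: ynb; rewrite inE => /andP[].
have {}y1 : k [set y; p] \notin used by move: y1; rewrite inE ynb.
pose phi' v := if v == e then y else phi v.
have old f : f != e -> phi' f = phi f by move=> /negPf fe; rewrite /phi' fe.
have old_par f : f != rt -> clk f <= m -> par f != e.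
  move=> f0; rewrite -em => fm; apply/eqP=> pf.
  have := parent_clock f0; rewrite pf => /(_ e0); lia.
have neq_e f : clk f < m -> f != e by apply: contraTneq => ->; rewrite em ltnn.
have phi'_e : phi' e = y by rewrite /phi' eqxx.
have phi'_pe : phi' (par e) = p by rewrite old // parent_neq.
have img f : f != rt -> clk f < m -> edge_image phi' f = edge_image phi f.
  by move=> f0 fm; rewrite /edge_image (old f) ?neq_e // old ?old_par // ltnW.
have stp f : f != rt -> clk f < m -> step phi' f = step phi f.
  by move=> f0 fm; rewrite /step (old f) ?neq_e // old ?old_par // ltnW.
have cases f : clk f < m.+1 -> f = e \/ clk f < m.
  rewrite ltnS leq_eqVlt => /orP[/eqP fm|]; last by right.
  by left; apply: (@clock_inj _ R l); rewrite fm em.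
exists phi'; split.
- by rewrite old // eq_sym.
- move=> v v0' /cases[->|vm]; first by rewrite phi'_e phi'_pe.
  by rewrite (old v) ?neq_e // old ?old_par ?phi_adj // ltnW.
- move=> g f g0 f0 fg /cases[eg|gm]; last first.
    by rewrite !img ?phi_col // (ltn_trans fg).
  rewrite eg in fg *; rewrite (img f) -?em // /edge_image phi'_e phi'_pe.
  apply: contraNneq y1 => ->; apply/imsetP; exists f => //.
  by rewrite inE f0 fg.
- move=> g f g0 f0 fg /cases[eg|gm] fgd; last first.
    by rewrite !stp ?phi_step // (ltn_trans fg).
  rewrite eg in fg fgd *; rewrite [step phi' f]stp // -?em // /step phi'_e phi'_pe.
  apply: contraNneq y2 => yp; apply/imsetP; exists f => //.
  by rewrite /step -yp addrC subrK.
Qed.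

Lemma greedy_embedding v0 : v0 \in verts G ->
  exists phi : V -> X,
  [/\ phi rt = v0,
      forall v, v != rt -> adj G (phi (par v)) (phi v),
      forall e f, e != rt -> f != rt -> e != f ->
        k (edge_image phi e) != k (edge_image phi f)
    & forall e f, e != rt -> f != rt -> clk f < clk e ->
        f \in guarded e -> step phi e != step phi f].
Proof.
move=> v0G; have emb m : exists phi, partial_embedding v0 m phi.
  elim: m => [|m [phi]]; last exact: partial_embeddingS.
  by exists (fun=> v0); split=> // *; lia.
pose M := (\max_v clk v).+1.
have ltM v : clk v < M by rewrite ltnS; apply: leq_bigmax.
have [phi [phi_rt phi_adj phi_col phi_step]] := emb M.
exists phi; split=> // [v v0'|e f e0 f0 ef|e f e0 f0 fe]; first exact: phi_adj.
  case: (ltngtP (clk e) (clk f)) => [lt|lt|/clock_inj ef']; last by rewrite ef' eqxx in ef.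
    by rewrite eq_sym; apply: phi_col.
  exact: phi_col.
exact: phi_step.
Qed.

End Greedy.

(** * Closed walks in the cube *)

Section Cube.

Local Open Scope ring_scope.

Variable n : nat.

Lemma F2_sub (a b : 'F_2) : a - b = (a != b)%:R.
Proof.
by apply/val_inj; case: a b => [[|[|?]] ?] [[|[|?]] ?].
Qed.

Lemma F2_addvv (z : 'rV['F_2]_n) : z + z = 0.
Proof.
apply/rowP=> i; rewrite !mxE; apply/val_inj.
by case: (z _ _) => [[|[|?]] ?].
Qed.

Lemma cube_adjC (x y : 'rV['F_2]_n) : cube_adj x y = cube_adj y x.
Proof.
by rewrite /cube_adj; congr (_ == 1%N); apply: eq_card => i; rewrite !inE eq_sym.
Qed.

Lemma cube_adj_sub (x y : 'rV['F_2]_n) :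
  cube_adj x y -> exists i, y - x = delta_mx ord0 i.
Proof.
case/cards1P=> i xy; exists i; apply/rowP=> j; rewrite !mxE F2_sub eqxx /=.
by move/setP/(_ j): xy; rewrite !inE eq_sym => ->.
Qed.

Lemma cube_subgraph_sub (G : sgraph 'rV['F_2]_n) x y :
  subgraph G (hypercube n) -> adj G x y -> exists i, y - x = delta_mx ord0 i.
Proof.
case/andP=> _ /subsetP sub /sub; rewrite inE => /existsP[x' /existsP[y']].
case/andP=> /eqP eq_xy adj_xy; have adj_yx := adj_xy; rewrite cube_adjC in adj_yx.
have x_in : x \in [set x'; y'] by rewrite -eq_xy !inE eqxx.
have y_in : y \in [set x'; y'] by rewrite -eq_xy !inE eqxx orbT.
have x_y : x != y.
  have x'_y' : x' != y'.
    apply: contraTneq adj_xy => ->; rewrite /cube_adj (_ : [set i | _] = set0) ?cards0 //.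
    by apply/setP=> i; rewrite !inE eqxx.
  have : (#|[set x; y]| = 2)%N by rewrite eq_xy cards2 x'_y'.
  by rewrite cards2; case: (x != y).
case/set2P: x_in x_y => ->; case/set2P: y_in => ->; rewrite ?eqxx // => _;
  exact: cube_adj_sub.
Qed.

Variable (V : finType).

Lemma even_directions (P : {set V}) (iota : V -> 'I_n) (i : 'I_n) :
  \sum_(f in P) delta_mx ord0 (iota f) = 0 :> 'rV['F_2]_n ->
  ~~ odd #|[set f in P | iota f == i]|.
Proof.
move=> /rowP/(_ i); rewrite summxE !mxE => sum0.
rewrite -dvdn2 (dvdn_pcharf (pchar_Fp (isT : prime 2))) -{}sum0; apply/eqP.
rewrite -sum1_card natr_sum big_mkcond [RHS]big_mkcond; apply: eq_bigr => f _.
by rewrite inE mxE eqxx eq_sym; case: (f \in P) => //=; case: eqP.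
Qed.

Lemma card_directions (P : {set V}) (iota : V -> 'I_n) :
  #|P| = (\sum_i #|[set f in P | iota f == i]|)%N.
Proof.
rewrite -sum1_card (partition_big iota predT) //=; apply: eq_bigr => i _.
by rewrite -sum1_card; apply: eq_bigl => f; rewrite inE.
Qed.

Lemma even_card_closed (P : {set V}) (iota : V -> 'I_n) :
  \sum_(f in P) delta_mx ord0 (iota f) = 0 :> 'rV['F_2]_n -> ~~ odd #|P|.
Proof.
move=> sum0; rewrite (card_directions P iota) -dvdn2; apply: dvdn_sum => i _.
by rewrite dvdn2 even_directions.
Qed.

(** Every direction used by [S] is used again outside [S]. *)
Lemma card_injective_part (P S : {set V}) (iota : V -> 'I_n) : S \subset P ->
    {in S &, injective iota} ->
  \sum_(f in P) delta_mx ord0 (iota f) = 0 :> 'rV['F_2]_n ->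
  (#|S|.*2 <= #|P|)%N.
Proof.
move=> SP iota_inj sum0; rewrite (card_directions P iota) -(card_in_imset iota_inj).
rewrite -muln2 -sum_nat_const big_mkcond /=; apply: leq_sum => i _.
case: ifP => // /imsetP[f fS ->].
have : (0 < #|[set g in P | iota g == iota f]|)%N.
  by apply/card_gt0P; exists f; rewrite inE (subsetP SP) ?eqxx.
by have := even_directions (iota f) sum0; case: #|_| => [|[|]].
Qed.

Variable R : rooted_tree V.

Lemma sum_step (phi : V -> 'rV['F_2]_n) v :
  \sum_(f in ancestors R v) step R phi f = phi v - phi (tree_root R).
Proof.
have [d] := ubnP (depth R v); elim: d v => // d IHd v lt_vd.
have [->|v0] := eqVneq v (tree_root R).
  rewrite subrr big_pred0 // => f; apply/ancestorsP=> -[i].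
  by rewrite depth_root.
rewrite (ancestorsS v0) big_setU1 /=; last first.
  apply/negP=> /depth_ancestors; rewrite (depth_parent v0); lia.
rewrite IHd; last by have := depth_parent v0; lia.
by rewrite /step addrA subrK.
Qed.

(** The shared ancestors of [u] and [w] cancel out, and signs do not matter in
    characteristic 2. *)
Lemma sum_step_branches (phi : V -> 'rV['F_2]_n) u w : phi u = phi w ->
  \sum_(f in branches R u w) step R phi f = 0.
Proof.
move=> eq_uw; rewrite (eq_bigl _ _ (fun f => in_setU f _ _)) bigU /=; last first.
  by rewrite -setI_eq0; apply/eqP/setP=> f; rewrite !inE; case: (f \in _); rewrite ?andbF.
have := congr2 (fun a b => a - b) (sum_step phi u) (sum_step phi w).
rewrite eq_uw subrr (big_setID (ancestors R w)) /= [X in _ - X](big_setID (ancestors R u)) /=.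
rewrite setIC opprD addrACA subrr add0r => /subr0_eq ->.
exact: F2_addvv.
Qed.

End Cube.

Section InjectiveEmbedding.

Variables (n : nat) (n_gt0 : 0 < n).
Variables (V : finType) (R : rooted_tree V) (l : V).
Hypothesis l_neq_root : l != tree_root R.
Hypothesis parent_l : parent R l = tree_root R.
Hypothesis l_childless : forall v, v != tree_root R -> parent R v != l.

Variables (G : sgraph 'rV['F_2]_n) (GQ : subgraph G (hypercube n)).
Variables (K : finType) (k : {set 'rV['F_2]_n} -> K).
Hypothesis G_neq0 : verts G != set0.
Hypothesis k_proper : forall p y y', adj G p y -> adj G p y' ->
  k [set y; p] = k [set y'; p] -> y = y'.
Hypothesis G_degree : forall p, p \in verts G -> #|V|.-1 <= degree G p.

Lemma rainbow_embedding : exists phi : V -> 'rV['F_2]_n,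
  [/\ injective phi, phi (tree_root R) \in verts G,
      forall v, v != tree_root R -> adj G (phi (parent R v)) (phi v)
    & forall e f, e != tree_root R -> f != tree_root R -> e != f ->
        k (edge_image R phi e) != k (edge_image R phi f)].
Proof.
have [v0 v0G] := set0Pn _ G_neq0.
have [phi [phi_rt phi_adj phi_col phi_step]] := greedy_embedding
  l_childless k_proper G_degree v0G.
exists phi; split=> //; [move=> u w eq_uw | by rewrite phi_rt].
apply/eqP/negPn/negP=> u_w.
pose iota v := odflt (Ordinal n_gt0) [pick i | step R phi v == delta_mx ord0 i]%R.
have iotaP v : v != tree_root R -> step R phi v = delta_mx ord0 (iota v).
  move=> v0'; rewrite /iota; case: pickP => [i /eqP //|no_i].
  by have [i e] := cube_subgraph_sub GQ (phi_adj v v0'); have := no_i i; rewrite /step e eqxx.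
have iota_sep e f : e != tree_root R -> f != tree_root R ->
    clock R l f < clock R l e -> (f \in guarded R l e) || incident R e f ->
    iota e != iota f.
  move=> e0 f0 fe ef; apply/eqP=> eq_iota.
  have eq_step : step R phi e = step R phi f by rewrite !iotaP // eq_iota.
  have e_f : e != f by apply: contraTneq fe => ->; rewrite ltnn.
  (* Equal directions at a common end would make the two edges coincide. *)
  case/or3P: ef => [/(phi_step _ _ e0 f0 fe)|/eqP pe|/eqP pe].
  - by rewrite eq_step eqxx.
  - have := phi_col e f e0 f0 e_f; rewrite /edge_image pe.
    have -> : phi e = phi (parent R f).
      move: eq_step; rewrite /step pe => /(congr1 (+%R^~ (phi f))); rewrite subrK => ->.
      by rewrite addrAC F2_addvv sub0r; apply/eqP; rewrite -subr_eq0 -opprD F2_addvv oppr0.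
    by rewrite setUC eqxx.
  - have := phi_col e f e0 f0 e_f; rewrite /edge_image pe.
    have -> : phi e = phi f by move: eq_step; rewrite /step pe => /addIr.
    by rewrite eqxx.
have sum0 : (\sum_(f in branches R u w) delta_mx ord0 (iota f) = 0 :> 'rV['F_2]_n)%R.
  apply: etrans (sum_step_branches R eq_uw); apply: eq_bigr => f fP.
  rewrite -[LHS]iotaP //; by case/setUP: fP => /setDP[/ancestors_neq_root].
have [S [SP S_inj]] := dir_inj_on_majority l_neq_root parent_l l_childless
  iota_sep u_w (even_card_closed sum0).
by rewrite ltnNge (card_injective_part SP S_inj sum0).
Qed.

End InjectiveEmbedding.

(** * Rooting an acyclic connected graph *)

Definition tree_rel (V : finType) (R : rooted_tree V) : rel V :=
  fun x y => (x != tree_root R) && (parent R x == y)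
          || (y != tree_root R) && (parent R y == x).

Section Rooting.

Variables (V : finType) (e : rel V).
Hypothesis e_sym : symmetric e.
Hypothesis e_irr : irreflexive e.
Hypothesis e_connected : forall x y, connect e x y.
Hypothesis e_acyclic : forall s : seq V, 3 <= size s -> ~ ucycle e s.

(** The parent is a neighbour closer to the root.  An edge of [e] between two
    vertices of which neither is the parent of the other would close a cycle
    with the path joining them in the tree of parents. *)
Lemma exists_rooting r :
  exists2 R : rooted_tree V, tree_root R = r & e =2 tree_rel R.
Proof.
pose reach n v := [exists p : n.-tuple V, path e r p && (last r p == v)].
have reachP n v : reflect (exists2 p, path e r p & size p = n /\ last r p = v) (reach n v).
  apply: (iffP existsP) => [[p /andP[rp /eqP lp]]|[p rp [sp lp]]].
    by exists p => //; rewrite size_tuple.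
  have sp' : size p == n by rewrite sp.
  by exists (Tuple sp'); rewrite /= rp lp eqxx.
have ex_reach v : exists n, reach n v.
  by have /connectP[p rp ->] := e_connected r v; exists (size p); apply/reachP; exists p.
pose dist v := ex_minn (ex_reach v).
have dist_reach v : reach (dist v) v by rewrite /dist; case: ex_minnP.
have dist_min n v : reach n v -> dist v <= n.
  by rewrite /dist; case: ex_minnP => m _ min_m /min_m.
have dist_r : dist r = 0.
  by apply/eqP; rewrite -leqn0; apply: dist_min; apply/reachP; exists [::].
pose par v := odflt v [pick u | e u v & dist v == (dist u).+1].
have par_r : par r = r.
  by rewrite /par; case: pickP => //= u; rewrite dist_r andbF.
have parP v : v != r -> e (par v) v /\ dist v = (dist (par v)).+1.
  move=> v_r; rewrite /par; case: pickP => [u /andP[uv /eqP] //|no_u].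
  have /reachP[p] := dist_reach v; case/lastP: p => [_ []|p z].
    by move=> _ /= rv; rewrite -rv eqxx in v_r.
  rewrite rcons_path last_rcons size_rcons => /andP[rp pz] [sp zv].
  have := no_u (last r p); rewrite /= -{1}zv pz /=; case/negP; rewrite eqn_leq.
  have le1 : dist (last r p) <= size p by apply: dist_min; apply/reachP; exists p.
  have [q rq [sq lq]] := reachP _ _ (dist_reach (last r p)).
  have le2 : dist v <= (dist (last r p)).+1.
    apply: dist_min; apply/reachP; exists (rcons q v).
      by rewrite rcons_path rq lq -zv.
    by rewrite size_rcons sq last_rcons.
  by rewrite le2 -sp ltnS.
pose R := @RootedTree V r par dist par_r dist_r (fun v v_r => proj2 (parP v v_r)).
exists R => // x y; apply/idP/idP => [xy|]; last first.
  case/orP=> /andP[z_r /eqP /= <-]; have [] := parP _ z_r => //.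
  by rewrite e_sym.
have F_e : subrel (tree_rel R) e.
  move=> u v /orP[]/andP[z_r /eqP /= <-]; have [] := parP _ z_r => //.
  by rewrite e_sym.
have F_sym : connect_sym (tree_rel R).
  by apply: sym_connect_sym => u v; rewrite /tree_rel orbC.
have F_root u : connect (tree_rel R) u r.
  have [d] := ubnP (dist u); elim: d u => // d IHd u lt_ud.
  have [->|u_r] := eqVneq u r; first exact: connect0.
  apply: connect_trans (IHd (par u) _).
    by apply: connect1; rewrite /tree_rel /= u_r eqxx.
  by have [_] := parP u u_r; lia.
apply: contraT => notF.
have : connect (tree_rel R) x y by apply: connect_trans (F_root x) _; rewrite F_sym F_root.
case/connectP=> p0 Fp0 ylast; rewrite ylast in xy notF.
case/shortenP: Fp0 xy notF => p Fp uniq_p _ xy notF.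
have Ep : path e x p by apply: sub_path Fp.
case: p => [|z [|z' p]] in Fp Ep uniq_p xy notF *.
- by rewrite /= e_irr in xy.
- by move: Fp notF; rewrite /= andbT => ->.
case: (@e_acyclic [:: x, z, z' & p] isT); rewrite /ucycle uniq_p andbT.
by rewrite (cycle_path x) /= e_sym xy; move: Ep => /=.
Qed.

(** A vertex at maximal depth has no neighbour other than its parent. *)
Lemma exists_leaf : 1 < #|V| ->
  exists l x, [/\ l != x, e l x & forall y, e l y -> y = x].
Proof.
case/card_gt1P=> r [v [_ _ r_v]].
have [R Rr eR] := exists_rooting r.
have [l _ max_l] := @arg_maxnP V v predT (depth R) isT.
have l_r : l != tree_root R.
  rewrite -depth_eq0 -lt0n; apply: leq_trans (max_l v isT).
  by rewrite lt0n depth_eq0 Rr eq_sym.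
exists l, (parent R l); split.
- by apply/eqP=> el; have := depth_parent l_r; rewrite -el; lia.
- by rewrite eR /tree_rel l_r eqxx.
move=> y; rewrite eR => /orP[/andP[_ /eqP //]|/andP[y_r /eqP yl]].
by have := depth_parent y_r; rewrite yl; have := max_l y isT; lia.
Qed.

Lemma rooting_next_to_leaf : 1 < #|V| -> exists (R : rooted_tree V) (l : V),
  [/\ e =2 tree_rel R, l != tree_root R, parent R l = tree_root R
    & forall v, v != tree_root R -> parent R v != l].
Proof.
move=> /exists_leaf[l [x [l_x lx l_uniq]]].
have [R Rx eR] := exists_rooting x.
exists R, l; rewrite Rx; split=> //.
  by apply: l_uniq; rewrite eR /tree_rel Rx l_x eqxx.
move=> v v_x; apply: contraNneq v_x => pv; apply/eqP.
apply: l_uniq; rewrite e_sym eR /tree_rel Rx pv eqxx andbT.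
by apply/orP; left; apply: contraTneq lx => vx; rewrite -pv vx -Rx parent_root Rx e_irr.
Qed.

End Rooting.

(** * Rainbow copies *)

Section VertexType.

Variables (W : finType) (T : sgraph W).

Local Notation V := {x : W | x \in verts T}.

Definition vertex_rel : rel V := fun x y => adj T (val x) (val y).

Lemma vertex_rel_sym : symmetric vertex_rel.
Proof. by move=> x y; apply: adjC. Qed.

Lemma vertex_rel_irr : irreflexive vertex_rel.
Proof. by move=> x; apply/negP=> /adj_neq; rewrite eqxx. Qed.

Lemma vertex_rel_connected : connected T -> forall x y, connect vertex_rel x y.
Proof.
move=> T_conn x y; have /connectP[p xp yp] := T_conn _ _ (valP x) (valP y).
elim: p x xp yp => [|z p IHp] x /=; first by move=> _ /val_inj->.
case/andP=> xz zp yp; pose z' : V := Sub z (adj_verts xz).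
by apply: connect_trans (connect1 (_ : vertex_rel x z')) (IHp z' zp yp).
Qed.

Lemma vertex_rel_acyclic : acyclic T ->
  forall s : seq V, 3 <= size s -> ~ ucycle vertex_rel s.
Proof.
move=> T_acyc s s3 /andP[cyc_s uniq_s]; apply: (T_acyc (map val s)).
  by rewrite size_map.
rewrite /ucycle map_inj_uniq ?uniq_s ?andbT //; last exact: val_inj.
by case: s cyc_s {s3 uniq_s} => //= x s; rewrite -map_rcons path_map.
Qed.

Lemma card_verts_rooted (R : rooted_tree V) : vertex_rel =2 tree_rel R ->
  #|[set: V]|.-1 <= #|edges T|.
Proof.
move=> TR; pose f (v : V) := [set val v; val (parent R v)].
have -> : #|[set: V]|.-1 = #|[set~ tree_root R]| by rewrite cardsC1 cardsT.
have f_inj : {in [set~ tree_root R] &, injective f}.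
  move=> u v; rewrite !inE => u0 v0 fuv.
  have : u \in [set v; parent R v].
    have : val u \in f v by rewrite -fuv !inE eqxx.
    by rewrite !inE.
  have : v \in [set u; parent R u].
    have : val v \in f u by rewrite fuv !inE eqxx.
    by rewrite !inE.
  case/set2P=> // vu /set2P[] // uv.
  by have := depth_parent u0; have := depth_parent v0; rewrite -vu -uv; lia.
rewrite -(card_in_imset f_inj); apply/subset_leq_card/subsetP=> _ /imsetP[v v0 ->].
have : vertex_rel v (parent R v) by rewrite TR /tree_rel -in_setC1 v0 eqxx.
by [].
Qed.

End VertexType.

Section Image.

Variables (W : finType) (T : sgraph W).
Local Notation V := {x : W | x \in verts T}.

Variables (R : rooted_tree V) (TR : vertex_rel (T := T) =2 tree_rel R).
Variables (X : finZmodType) (G : sgraph X) (C : Type) (c : edge G -> C).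
Variables (K : finType) (k : {set X} -> K).
Hypothesis kP : forall e f : edge G, k (val e) = k (val f) <-> c e = c f.

Variable phi : V -> X.
Hypothesis phi_inj : injective phi.
Hypothesis phi_root : phi (tree_root R) \in verts G.
Hypothesis phi_adj : forall v, v != tree_root R -> adj G (phi (parent R v)) (phi v).
Hypothesis phi_rainbow : forall e f, e != tree_root R -> f != tree_root R ->
  e != f -> k (edge_image R phi e) != k (edge_image R phi f).

Lemma rainbow_copy_of_embedding : exists H : sgraph X, rainbow_copy c T H.
Proof.
pose vH := phi @: [set: V]; pose eH := edge_image R phi @: [set~ tree_root R].
have eHP : [forall e in eH, (e \subset vH) && (#|e| == 2)].
  apply/forall_inP=> _ /imsetP[v v0 ->]; rewrite !inE in v0.
  rewrite cards2 (eq_sym (phi v)) (adj_neq (phi_adj v0)) andbT.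
  by apply/subsetP=> y /set2P[] ->; apply: imset_f; rewrite inE.
exists (SGraph eHP); split.
- apply/andP; split; apply/subsetP=> _ /imsetP[v v0 ->].
    have [->//|/phi_adj] := eqVneq v (tree_root R); exact: adj_verts.
  by rewrite !inE in v0; have := phi_adj v0; rewrite /adj /edge_image setUC.
- pose F (x : V) : {y | y \in vH} := exist _ (phi x) (imset_f phi (in_setT x)).
  exists F; split.
    apply: inj_card_bij => [x y /(congr1 val) /phi_inj //|].
    rewrite card_sig (eq_card (_ : _ =i vH)) //.
    by apply: leq_trans (leq_imset_card _ _) _; rewrite cardsT.
  move=> x y; rewrite -[LHS]/(vertex_rel x y) TR /adj /=.
  have phi2 a b : [set phi a; phi b] = phi @: [set a; b].
    by rewrite imsetU !imset_set1.
  apply/orP/imsetP => [[]/andP[z0 /eqP <-]|[z z0]].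
  + by exists x; rewrite ?inE.
  + by exists y; rewrite ?inE // /edge_image setUC.
  rewrite /edge_image !phi2 => /(imset_inj phi_inj) xyz.
  have x_z : x \in [set z; parent R z] by rewrite -xyz !inE eqxx.
  have y_z : y \in [set z; parent R z] by rewrite -xyz !inE eqxx orbT.
  have z_x : z \in [set x; y] by rewrite xyz !inE eqxx.
  have p_x : parent R z \in [set x; y] by rewrite xyz !inE eqxx orbT.
  rewrite !inE in z0 x_z y_z z_x p_x.
  have pz : parent R z == z = false by apply/negbTE/parent_neq.
  case/orP: z_x => /eqP zx; rewrite -zx in p_x *; rewrite z0 /=.
    by left; move: p_x; rewrite pz.
  by right; move: p_x; rewrite pz orbF.
- move=> e f /imsetP[v v0 ev] /imsetP[w w0 fw] e_f /kP; rewrite ev fw.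
  rewrite !inE in v0 w0; apply/eqP/phi_rainbow => //.
  by apply/eqP=> vw; apply: e_f; apply: val_inj; rewrite ev fw vw.
Qed.

End Image.

Theorem theorem1p2 (n : nat) (n_gt0 : 0 < n)
    (G : sgraph 'rV['F_2]_n) (GQ : subgraph G (hypercube n))
    (G_neq0 : verts G != set0)
    (C : Type) (c : edge G -> C) (c_proper : proper_coloring c)
    (W : finType) (T : sgraph W) (T_tree : tree T)
    (T_edges : #|edges T| <= min_degree G) :
  exists H : sgraph 'rV['F_2]_n, rainbow_copy c T H.
Proof.
have [T_neq0 T_conn T_acyc] := T_tree.
have [K [k kP]] := coloring_code c.
have k_proper p y y' : adj G p y -> adj G p y' ->
    k [set y; p] = k [set y'; p] -> y = y'.
  move=> py py' eq_k; apply/eqP/negPn/negP=> y_y'.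
  pose e : edge G := exist _ [set p; y] py; pose e' : edge G := exist _ [set p; y'] py'.
  apply: (c_proper e e'); last by apply/kP; rewrite /= setUC eq_k setUC.
    move=> /(congr1 val) /= /setP /(_ y); rewrite !inE eqxx orbT (negPf y_y') orbF.
    by move=> /esym/eqP yp; have := adj_neq py; rewrite yp eqxx.
  by apply/set0Pn; exists p; rewrite !inE eqxx.
have conn := vertex_rel_connected T_conn.
have acyc := vertex_rel_acyclic T_acyc.
pose V : finType := {x : W | x \in verts T}.
have [V_gt1|V_le1] := ltnP 1 #|V|; last first.
  have [v0 v0G] := set0Pn _ G_neq0; have [x xT] := set0Pn _ T_neq0.
  have [R Rx TR] := exists_rooting (@vertex_rel_sym _ T) (@vertex_rel_irr _ T)
    conn acyc (Sub x xT).
  have V1 (u v : V) : u = v by apply: (fintype_le1P V_le1).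
  apply: (rainbow_copy_of_embedding TR kP (phi := fun=> v0)) => //.
  - by move=> v; rewrite (V1 v (tree_root R)) eqxx.
  - by move=> e f; rewrite (V1 e (tree_root R)) eqxx.
have [R [l [TR l_root pl l_leaf]]] := rooting_next_to_leaf
  (@vertex_rel_sym _ T) (@vertex_rel_irr _ T) conn acyc V_gt1.
have G_degree p : p \in verts G -> #|V|.-1 <= degree G p.
  move=> pG; apply: leq_trans (min_degree_le pG).
  by apply: leq_trans T_edges; rewrite -cardsT (card_verts_rooted TR).
have [phi [phi_inj phi_root phi_adj phi_rainbow]] := rainbow_embedding
  n_gt0 l_root pl l_leaf GQ G_neq0 k_proper G_degree.
exact (rainbow_copy_of_embedding (X := _) TR kP phi_inj phi_root phi_adj phi_rainbow).
Qed.
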